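(* Let $\mathcal{H}=\mathcal{H}(X)$ be a reproducing kernel Hilbert space, let $A\in\mathscr{B}(\mathcal{H})$, let $\sigma,\rho,\tau$ be symmetric means with corresponding interpolational paths $(\sigma_t)_{t\in[0,1]}$, $(\rho_t)_{t\in[0,1]}$, $(\tau_t)_{t\in[0,1]}$, and let $\mu,\nu,\lambda\in[0,1]$. If $f$ is an Orlicz function, then $$ f\big(\mathrm{ber}^2(A)\big)\le\Big(f\big(\mathrm{ber}^2(A)\big)\ \sigma_\mu\ f\big(\mathrm{ber}(A)\,\|A^*A\|_{\mathrm{ber}}^{1/2}\big)\Big)\ \rho_\lambda\ \Big(f\big(\mathrm{ber}^2(A)\big)\ \tau_\nu\ \tfrac12\big\|f(|A|^2)+f(|A^*|^2)\big\|_{\mathrm{ber}}\Big). $$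
   Context: Reproducing kernel Hilbert space: $X$ is a non-empty set and $\mathcal{H}=\mathcal{H}(X)$ is a Hilbert space of complex-valued functions on $X$ such that for every $x\in X$ the evaluation $\phi\mapsto\phi(x)$ is continuous on $\mathcal{H}$. For $x\in X$, $k_x\in\mathcal{H}$ is the unique element with $\phi(x)=\langle\phi,k_x\rangle$ for all $\phi\in\mathcal{H}$, and $\hat k_x=k_x/\|k_x\|$ is the normalized reproducing kernel (so it is implicit that $k_x\neq 0$ for all $x\in X$). $\mathscr{B}(\mathcal{H})$ is the algebra of bounded linear operators on $\mathcal{H}$, and $|T|=(T^*T)^{1/2}$. For $T\in\mathscr{B}(\mathcal{H})$, the Berezin number is $\mathrm{ber}(T)=\sup_{x\in X}|\langle T\hat k_x,\hat k_x\rangle|$ and the Berezin norm is $\|T\|_{\mathrm{ber}}=\sup_{x,y\in X}|\langle T\hat k_x,\hat k_y\rangle|$; $\mathrm{ber}^s(T)$ means $(\mathrm{ber}(T))^s$. Mean: a function $\sigma:[0,\infty)\times[0,\infty)\to[0,\infty)$ such that (1) $\sigma(a,b)\ge0$; (2) $a\le\sigma(a,b)\le b$ if $a\le b$; (3) $\sigma$ is monotone increasing in both variables; (4) $\sigma(\alpha a,\alpha b)=\alpha\sigma(a,b)$ for all $\alpha>0$; (5) $\sigma$ is continuous in $a$ and $b$. It is symmetric if $\sigma(a,b)=\sigma(b,a)$. An interpolational path for a symmetric mean $\sigma$ is a family $(\sigma_t)_{t\in[0,1]}$ of means on $[0,\infty)\times[0,\infty)$ such that (i) $\sigma_0(a,b)=a$,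 $\sigma_1(a,b)=b$, $\sigma_{1/2}(a,b)=\sigma(a,b)$ for all $a,b\ge0$; (ii) $\sigma(\sigma_s(a,b),\sigma_t(a,b))=\sigma_{(s+t)/2}(a,b)$ for all $s,t\in[0,1]$; (iii) each $\sigma_t$ is increasing in each of its components. One writes $a\,\sigma_t\,b$ for $\sigma_t(a,b)$. Orlicz function: a continuous, convex, non-decreasing $f:[0,\infty)\to[0,\infty)$ with $f(0)=0$ and $f(u)\to\infty$ as $u\to\infty$; throughout, Orlicz functions are assumed non-degenerate, i.e. $f(u)>0$ for all $u>0$. For a positive operator $T$, $f(T)$ is defined by the continuous functional calculus. *)

(* Defs.v *)
From HB Require Import structures.
From mathcomp Require Export all_boot all_order all_algebra.
From mathcomp.real_closed Require Export complex.
From mathcomp Require Export all_classical all_reals all_analysis.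

Set Implicit Arguments.
Unset Strict Implicit.
Unset Printing Implicit Defensive.

Import Order.TTheory GRing.Theory Num.Theory.
Import numFieldNormedType.Exports.

Local Open Scope classical_set_scope.
Local Open Scope ring_scope.
Local Open Scope complex_scope.

(* The elements of the space are identified with functions on X through the
   injective linear map [ev], [ev phi x] being the value phi(x).  The inner
   product is linear on the left and conjugate-linear on the right. *)
Record rkhs (R : realType) (X : Type) := RKHS {
  space :> completeNormedModType R[i];
  dot : {dot space for Num.conj};
  dot_norm : forall u, dot u u = `|u| ^+ 2;
  ev : {linear space -> (X -> R[i])};
  ev_inj : injective ev;
  ev_continuous : forall x, continuous (fun phi : space => ev phi x : R[i]^o)
}.

Section Operators.
Variables (R : realType) (X : Type) (H : rkhs R X).
Implicit Types (T S : H -> H) (x y : X).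

Definition bounded_op T : Prop := linear T /\ continuous T.

Definition kernel x : H := get [set k : H | forall phi, ev H phi x = dot H phi k].

Definition nkernel x : H := `|kernel x|^-1 *: kernel x.

Definition ber T : R :=
  sup [set complex.Re `|dot H (T (nkernel x)) (nkernel x)| | x in [set: X]].

Definition ber_norm T : R :=
  sup [set complex.Re `|dot H (T (nkernel xy.1)) (nkernel xy.2)|
      | xy in [set: X * X]].

Definition adjoint T : H -> H :=
  get [set S | bounded_op S /\ forall u v, dot H (T u) v = dot H u (S v)].

Definition spectrum T : set R[i] :=
  [set z | ~ exists S, [/\ bounded_op S,
      cancel (fun v => T v - z *: v) S & cancel S (fun v => T v - z *: v)]].

Definition op_horner (p : {poly R}) T : H -> H :=
  fun v => \sum_(i < size p) (p`_i)%:C *: iter i T v.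

(* [S = f(T)] for [T] self-adjoint (so that the spectrum of [T] is real) and
   [f] continuous on it: [S] is the limit in operator norm of [p(T)] as the
   polynomial [p] tends to [f] uniformly on the spectrum of [T]. *)
Definition is_cfc (f : R -> R) T S : Prop :=
  bounded_op S /\
  forall e : R, 0 < e -> exists2 d : R, 0 < d &
    forall p : {poly R},
      (forall t : R, spectrum T t%:C -> `|p.[t] - f t| <= d) ->
      forall v, `|S v - op_horner p T v| <= e%:C * `|v|.

Definition cfc (f : R -> R) T : H -> H := get [set S | is_cfc f T S].

Definition absop T : H -> H := cfc Num.sqrt (adjoint T \o T).

End Operators.

(* Functions on [0, +oo) are total functions on R whose values at negative
   arguments are left unconstrained. *)

Record is_mean (R : realType) (s : R -> R -> R) : Prop := IsMean {
  mean_ge0 : forall a b, 0 <= a -> 0 <= b -> 0 <= s a b;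
  mean_between : forall a b, 0 <= a -> a <= b -> a <= s a b <= b;
  mean_monotone : forall a a' b b', 0 <= a -> a <= a' -> 0 <= b -> b <= b' ->
    s a b <= s a' b';
  mean_homogeneous : forall c a b, 0 < c -> 0 <= a -> 0 <= b ->
    s (c * a) (c * b) = c * s a b;
  mean_continuousl : forall b, 0 <= b ->
    {within `[0, +oo[, continuous (fun a => s a b)};
  mean_continuousr : forall a, 0 <= a ->
    {within `[0, +oo[, continuous (fun b => s a b)}
}.

Definition is_symmetric_mean (R : realType) (s : R -> R -> R) : Prop :=
  is_mean s /\ forall a b, 0 <= a -> 0 <= b -> s a b = s b a.

Record is_interpolational_path (R : realType) (s : R -> R -> R)
    (st : R -> R -> R -> R) : Prop := IsInterpolationalPath {
  path_mean : forall t, 0 <= t <= 1 -> is_mean (st t);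
  path0 : forall a b, 0 <= a -> 0 <= b -> st 0 a b = a;
  path1 : forall a b, 0 <= a -> 0 <= b -> st 1 a b = b;
  path_half : forall a b, 0 <= a -> 0 <= b -> st 2^-1 a b = s a b;
  path_mid : forall p q a b, 0 <= p <= 1 -> 0 <= q <= 1 -> 0 <= a -> 0 <= b ->
    s (st p a b) (st q a b) = st ((p + q) / 2) a b;
  path_monotone : forall t a a' b b', 0 <= t <= 1 ->
    0 <= a -> a <= a' -> 0 <= b -> b <= b' -> st t a b <= st t a' b'
}.

Record is_orlicz (R : realType) (f : R -> R) : Prop := IsOrlicz {
  orlicz_ge0 : forall u, 0 <= u -> 0 <= f u;
  orlicz_continuous : {within `[0, +oo[, continuous f};
  orlicz_convex : convex_function (`[0, +oo[ : set R) f;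
  orlicz_nondecreasing : {in `[0, +oo[ &, {homo f : u v / u <= v}};
  orlicz0 : f 0 = 0;
  orlicz_cvg : f u @[u --> +oo] --> +oo;
  orlicz_gt0 : forall u, 0 < u -> 0 < f u
}.

(* Main.v *)
From HB Require Import structures.
From mathcomp Require Import ring lra.
Require Import Defs.

(* Both arguments of [rho] are at least [f (ber A ^+ 2)], and a mean of two
   numbers is at least their minimum; likewise for [sigma] and [tau].  The first
   bound is [|<A k, k>| <= |A k|] with [|A k| ^+ 2 = <A^* A k, k>].  For the second,
   [|<A k, k>|] is at most both [|A k|] and [|A^* k|], and [|A k| ^+ 2 = <T k, k>]
   for [T = A^* A = |A| ^+ 2], so the operator Jensen inequality
   [f (<T k, k>) <= <f(T) k, k>] applies to [A] and to [A^*].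

   The functional calculus rests on [|q(T)| <= sup |q|] over the spectrum, for
   [T] self-adjoint and [q] a real polynomial.  If [K = |q(T)|], then
   [q(T) ^+ 2 - K ^+ 2] is not bounded below; factoring the polynomial
   [q ^+ 2 - K ^+ 2] over the complex numbers yields a root [z] for which [T - z]
   is not bounded below, so [z] is real, lies in the spectrum, and
   [|q.[z]| = K]. *)

Import Order.TTheory GRing.Theory Num.Theory.
Import numFieldNormedType.Exports.

Set Implicit Arguments.
Unset Strict Implicit.
Unset Printing Implicit Defensive.

Local Open Scope classical_set_scope.
Local Open Scope ring_scope.

(** * Weierstrass approximation *)

Section Weierstrass.
Variable R : realType.

(** De Casteljau's recursion, with nodes kept as indices [0, ..., n]: the value at [x] is the mean
    of [h] over the number of successes in [n] independent trials of probability [x]. *)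
Fixpoint bernstein (n : nat) (h : nat -> R) : {poly R} :=
  if n is m.+1 then
    'X * bernstein m (h \o succn) + (1 - 'X) * bernstein m h
  else (h 0)%:P.

Lemma hornerB1X (p : {poly R}) x : ((1 - 'X) * p).[x] = (1 - x) * p.[x].
Proof. by rewrite !hornerE. Qed.

Lemma bernstein_le n (h h' : nat -> R) x : 0 <= x <= 1 ->
  (forall k, (k <= n)%N -> h k <= h' k) ->
  (bernstein n h).[x] <= (bernstein n h').[x].
Proof.
move=> /andP[x0 x1]; elim: n h h' => [|n IHn] h h' hh' /=.
  by rewrite !hornerC hh'.
rewrite !hornerD !hornerB1X !hornerM !hornerX lerD// ler_wpM2l ?subr_ge0//.
  by apply: IHn => k kn; apply: hh'.
by apply: IHn => k kn; apply: hh'; rewrite leqW.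
Qed.

(** Variance plus squared bias of the binomial law. The centre [a] is arbitrary because in the
    induction the shift by [succn] replaces it with [a - 1]. *)
Lemma bernstein_moment n (a b c x : R) :
  (bernstein n (fun k => b * (k%:R - a) ^+ 2 + c)).[x] =
  b * (n%:R * (x * (1 - x)) + (n%:R * x - a) ^+ 2) + c.
Proof.
elim: n a => [|n IHn] a /=; first by rewrite hornerC; ring.
rewrite hornerD hornerB1X hornerM hornerX IHn.
rewrite (_ : _ \o succn = fun k => b * (k%:R - (a - 1)) ^+ 2 + c); last first.
  by apply/funext => k /=; rewrite -natr1; congr (_ * _ ^+ 2 + _); ring.
by rewrite IHn -natr1; ring.
Qed.

Lemma within_continuous_dist (A : set R) (f : R -> R) :
  {within A, continuous f} -> forall x : R, A x -> forall e : R, 0 < e ->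
  exists2 d : R, 0 < d & forall y : R, A y -> `|x - y| < d -> `|f x - f y| < e.
Proof.
move=> /subspace_continuousP fc x Ax e e0.
have /cvgrPdist_lt/(_ e e0) := fc x Ax.
rewrite near_withinE near_simpl => /nbhs_ballP[d /= d0 dP].
by exists d => // y Ay xy; apply: dP.
Qed.

Lemma segment_unif_continuous (M : R) (f : R -> R) :
  {within `[0, M], continuous f} -> forall e : R, 0 < e ->
  exists2 d : R, 0 < d & forall x y : R, 0 <= x <= M -> 0 <= y <= M ->
    `|x - y| < d -> `|f x - f y| < e.
Proof.
move=> fc e e0.
have /compact_near_coveringP/near_covering_withinP cpt := @segment_compact R 0 M.
pose P (d x : R) := forall y : R, 0 <= y <= M -> `|x - y| < d -> `|f x - f y| < e.
have [x xM|d /= d0 dP] := cpt R (at_right (0:R)) P.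
  have e2 : 0 < e / 2 by rewrite divr_gt0.
  have [d d0 dP] := within_continuous_dist fc xM e2.
  (* Half of [d] for the neighbourhood of [x] and half for the scale keep both [x'] and [y] within
     [d] of [x]. *)
  exists (ball x (d / 2), [set r | r < d / 2]) => /=.
    split; first by apply: nbhsx_ballx; rewrite divr_gt0.
    by apply: nbhs_right_lt; rewrite divr_gt0.
  move=> [x' r] /= [xx' rd] x'M y yM x'y.
  rewrite /ball /= in xx'.
  have xy : `|x - y| < d.
    by rewrite (le_lt_trans (ler_distD x' _ _))// [d]splitr ltrD// (lt_trans x'y).
  have xx'd : `|x - x'| < d by rewrite (lt_trans xx')// ltr_pdivrMr// ltr_pMr// ltr1n.
  rewrite (le_lt_trans (ler_distD (f x) _ _))// [e]splitr ltrD//.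
    by rewrite distrC; apply: dP.
  by apply: dP; rewrite //= in_itv.
exists (d / 2); first by rewrite divr_gt0.
move=> x y xM yM xy; apply: (dP (d / 2)) => //; last by rewrite divr_gt0.
  by rewrite /= sub0r normrN gtr0_norm ?divr_gt0// ltr_pdivrMr// ltr_pMr// ltr1n.
Qed.

(* Chebyshev's argument: the error of the Bernstein polynomial is split into the
   oscillation of [f] at scale [d] and the second moment, which controls the
   nodes farther than [d]. *)
Lemma weierstrass (M : R) (f : R -> R) : 0 < M ->
  {within `[0, M], continuous f} -> forall e : R, 0 < e ->
  exists p : {poly R}, forall t : R, 0 <= t <= M -> `|p.[t] - f t| <= e.
Proof.
move=> M0 fc e e0.
have e2 : 0 < e / 2 by rewrite divr_gt0.
have [d d0 dP] := segment_unif_continuous fc e2.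
have [B BP] : exists B : R, forall x : R, 0 <= x <= M -> `|f x| <= B.
  have /compact_bounded[B [_ BP]] := continuous_compact fc (@segment_compact R 0 M).
  exists (B + 1) => x xM; apply: (BP (B + 1)); first by rewrite ltrDl.
  by exists x => //=; rewrite in_itv.
have B0 : 0 <= B by rewrite (le_trans _ (BP 0 _)) ?lexx ?(ltW M0).
(* With this constant the parabola [C * (y - x) ^+ 2] reaches [2 * B], a bound for any difference of
   values, as soon as [|y - x| >= d]. *)
pose C : R := 2 * B / d ^+ 2.
have C0 : 0 <= C by apply: divr_ge0; [apply: mulr_ge0|apply/exprn_ge0/ltW].
have osc (x y : R) : 0 <= x <= M -> 0 <= y <= M ->
    `|f y - f x| <= e / 2 + C * (y - x) ^+ 2.
  move=> xM yM; have [xy|xy] := ltP `|y - x| d.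
    rewrite -[leLHS]addr0 lerD ?(ltW (dP _ _ _ _ _))//.
    by rewrite mulr_ge0// exprn_even_ge0.
  rewrite -[leLHS]add0r lerD ?(ltW e2)//.
  rewrite (le_trans (ler_normB _ _))// (@le_trans _ _ (2 * B))//.
    by rewrite mulr2n mulrDl mul1r lerD ?BP.
  rewrite /C mulrAC -mulrA ler_peMr ?mulr_ge0// ler_pdivlMr ?exprn_gt0// mul1r.
  by rewrite -[leRHS]real_normK ?num_real// lerXn2r ?nnegrE// ltW.
(* As [x * (1 - x) <= 1], the variance contributes at most [C * M ^+ 2 / n.+1]; this [n] brings it
   below [e / 2]. *)
have [n nP] : exists n : nat, C * M ^+ 2 / (e / 2) < n.+1%:R.
  by exists (Num.truncn (C * M ^+ 2 / (e / 2))); apply: truncnS_gt.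
have n0 : 0 < n.+1%:R :> R by rewrite ltr0n.
pose h k : R := f (M * k%:R / n.+1%:R).
exists (bernstein n.+1 h \Po (M^-1 *: 'X)) => t tM.
rewrite horner_comp hornerZ hornerX; set x : R := M^-1 * t.
have x01 : 0 <= x <= 1.
  case/andP: tM => t0 tM; rewrite /x mulr_ge0 ?invr_ge0 ?(ltW M0)//=.
  by rewrite ler_pdivrMl// mulr1.
have node k : (k <= n.+1)%N -> 0 <= M * k%:R / n.+1%:R <= M.
  move=> kn; rewrite divr_ge0 ?mulr_ge0 ?(ltW M0)//= ler_pdivrMr// ler_wpM2l ?(ltW M0)//.
  by rewrite ler_nat.
have nodeE (k : nat) : M * k%:R / n.+1%:R - t = M / n.+1%:R * (k%:R - n.+1%:R * x).
  by rewrite /x; field; rewrite gt_eqF//= gt_eqF.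
have var : C * (M / n.+1%:R) ^+ 2 * (n.+1%:R * (x * (1 - x))) <= e / 2.
  have -> : C * (M / n.+1%:R) ^+ 2 * (n.+1%:R * (x * (1 - x))) =
      C * M ^+ 2 / n.+1%:R * (x * (1 - x)) by field; rewrite gt_eqF.
  rewrite (@le_trans _ _ (C * M ^+ 2 / n.+1%:R))//.
    apply: ler_piMr; last by case/andP: x01 => x0 x1; nra.
    by rewrite divr_ge0// mulr_ge0// exprn_ge0// ltW.
  by rewrite ler_pdivrMr// -ler_pdivrMl// mulrC ltW.
have lower (w : R) : w <= e / 2 -> - e + f t <= - w + (f t - e / 2) by lra.
have upper (w : R) : w <= e / 2 -> w + (f t + e / 2) <= e + f t by lra.
have lower' (a w : R) : - (e / 2 + w) <= a - f t -> - w + (f t - e / 2) <= a by lra.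
have upper' (a w : R) : a - f t <= e / 2 + w -> a <= w + (f t + e / 2) by lra.
(* The values of [f] at the nodes lie between two parabolas around [f t]. These are centred at
   [n.+1 * x], so at [x] their Bernstein polynomials have no bias and only the variance remains. *)
rewrite ler_norml lerBlDr lerBrDr; apply/andP; split.
  apply: (@le_trans _ _ (bernstein n.+1 (fun k =>
      - (C * (M / n.+1%:R) ^+ 2) * (k%:R - n.+1%:R * x) ^+ 2 + (f t - e / 2))).[x]).
    rewrite bernstein_moment subrr expr0n/= addr0 mulNr.
    exact: lower var.
  apply: bernstein_le => // k kn; have := osc _ _ tM (node _ kn).
  rewrite nodeE exprMn mulrA ler_norml /h => /andP[].
  by rewrite mulNr => + _ => /lower'.
apply: (@le_trans _ _ (bernstein n.+1 (fun k =>
    C * (M / n.+1%:R) ^+ 2 * (k%:R - n.+1%:R * x) ^+ 2 + (f t + e / 2))).[x]).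
  apply: bernstein_le => // k kn; have := osc _ _ tM (node _ kn).
  rewrite nodeE exprMn mulrA ler_norml /h => /andP[_].
  exact: upper'.
rewrite bernstein_moment subrr expr0n/= addr0.
exact: upper var.
Qed.
End Weierstrass.

(** * Real form of the inner product *)

Section Hilbert.
Local Open Scope complex_scope.
Variables (R : realType) (X : Type) (H : rkhs R X).
Implicit Types (u v w : H) (a b z : R[i]) (T S : H -> H).

(** The norm of the space is [R[i]]-valued but real; its real part loses nothing and allows ordered
    arithmetic in [R]. *)
Definition rnorm v : R := complex.Re `|v|.
Definition rdot u v : R := complex.Re (dot H u v).

Lemma normE v : `|v| = (rnorm v)%:C.
Proof. by rewrite /rnorm RRe_real// ger0_real. Qed.

Lemma rnorm_ge0 v : 0 <= rnorm v.
Proof. by rewrite -ler0c -normE. Qed.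

Lemma rnorm0 : rnorm 0 = 0.
Proof. by rewrite /rnorm normr0. Qed.

Lemma rnorm_eq0 v : rnorm v = 0 -> v = 0.
Proof. by move=> v0; apply/normr0_eq0; rewrite normE v0. Qed.

Lemma rnorm_gt0 v : v != 0 -> 0 < rnorm v.
Proof. by rewrite -normr_gt0 normE ltcR. Qed.

Lemma rnormN v : rnorm (- v) = rnorm v.
Proof. by rewrite /rnorm normrN. Qed.

Lemma rnormD u v : rnorm (u + v) <= rnorm u + rnorm v.
Proof. by rewrite -lecR rmorphD/= -!normE ler_normD. Qed.

Lemma rnormB u v : rnorm (u - v) <= rnorm u + rnorm v.
Proof. by rewrite -(rnormN v) rnormD. Qed.

Lemma rnorm_distC u v : rnorm (u - v) = rnorm (v - u).
Proof. by rewrite -rnormN opprB. Qed.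

Lemma rnorm_distD w u v : rnorm (u - v) <= rnorm (u - w) + rnorm (w - v).
Proof. by rewrite -[u - v](subrKA w) rnormD. Qed.

Definition cabs z : R := complex.Re `|z|.

Lemma cabsE z : `|z| = (cabs z)%:C.
Proof. by rewrite /cabs RRe_real// ger0_real. Qed.

Lemma cabs_ge0 z : 0 <= cabs z.
Proof. by rewrite -ler0c -cabsE. Qed.

Lemma cabs_real (r : R) : cabs r%:C = `|r|.
Proof. by rewrite /cabs normc_def/= expr0n/= addr0 sqrtr_sqr. Qed.

Lemma normr_Re_le z : `|complex.Re z| <= cabs z.
Proof. by rewrite -lecR -cabsE normc_ge_Re. Qed.

Lemma conjcM a b : (a * b)^*%C = a^*%C * b^*%C.
Proof. exact: rmorphM. Qed.

Lemma rnormZ z v : rnorm (z *: v) = cabs z * rnorm v.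
Proof.
by apply/complexI; rewrite rmorphM/= -cabsE -!normE normrZ.
Qed.

Lemma rnormZr (r : R) v : rnorm (r%:C *: v) = `|r| * rnorm v.
Proof. by rewrite rnormZ cabs_real. Qed.

Lemma dotC u v : dot H u v = (dot H v u)^*%C.
Proof. by have := hermC (dot H) u v; rewrite expr0 mul1r. Qed.

Lemma dotZl z u v : dot H (z *: u) v = z * dot H u v.
Proof. exact: linearZl_LR. Qed.

Lemma dotZr z u v : dot H u (z *: v) = z^*%C * dot H u v.
Proof. by rewrite dotC dotZl rmorphM/= -dotC. Qed.

Lemma rdotC u v : rdot u v = rdot v u.
Proof. by rewrite /rdot dotC; case: (dot H v u). Qed.

Lemma rdotDl u v w : rdot (u + v) w = rdot u w + rdot v w.
Proof. by rewrite /rdot linearDl raddfD. Qed.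

Lemma rdotBl u v w : rdot (u - v) w = rdot u w - rdot v w.
Proof. by rewrite /rdot linearBl raddfB. Qed.

Lemma rdotDr u v w : rdot u (v + w) = rdot u v + rdot u w.
Proof. by rewrite !(rdotC u) rdotDl. Qed.

Lemma rdotBr u v w : rdot u (v - w) = rdot u v - rdot u w.
Proof. by rewrite !(rdotC u) rdotBl. Qed.

Lemma rdotZl (r : R) u v : rdot (r%:C *: u) v = r * rdot u v.
Proof. by rewrite /rdot dotZl; case: (dot H u v) => x y; simpc. Qed.

Lemma rdotZr (r : R) u v : rdot u (r%:C *: v) = r * rdot u v.
Proof. by rewrite rdotC rdotZl rdotC. Qed.

Lemma rdotvv v : rdot v v = rnorm v ^+ 2.
Proof. by rewrite /rdot dot_norm normE -rmorphXn. Qed.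

(** The squared norm of [|v| u - |u| v] equals [2 |u| |v| (|u| |v| - rdot u v)] and is
    nonnegative. *)
Lemma rdot_le u v : rdot u v <= rnorm u * rnorm v.
Proof.
have [->|v0] := eqVneq v 0.
  by rewrite /rdot linear0r rnorm0 mulr0.
have [->|u0] := eqVneq u 0.
  by rewrite /rdot linear0l rnorm0 mul0r.
have := rdotvv ((rnorm v)%:C *: u - (rnorm u)%:C *: v).
rewrite rdotBl !rdotBr !rdotZl !rdotZr !rdotvv (rdotC v u).
set k := rnorm (_ - _) => E.
have : 0 <= (2 * rnorm u * rnorm v) * (rnorm u * rnorm v - rdot u v).
  rewrite (_ : _ * _ = k ^+ 2) ?sqr_ge0// -E; ring.
by rewrite pmulr_rge0 ?subr_ge0// !mulr_gt0 ?rnorm_gt0.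
Qed.

(** Multiplying [v] by the phase of [dot H u v] turns the inner product into its modulus, to which
    the real inequality applies. *)
Lemma dot_le u v : cabs (dot H u v) <= rnorm u * rnorm v.
Proof.
have [d0|d0] := eqVneq (dot H u v) 0.
  by rewrite d0 /cabs normr0 mulr_ge0 ?rnorm_ge0.
have n0 : `|dot H u v| != 0 by rewrite normr_eq0.
have := rdot_le u ((dot H u v / `|dot H u v|) *: v).
rewrite /rdot dotZr conjcM mulrAC.
rewrite [_^*%C * _]mulrC -sqr_normc expr2.
rewrite conjc_inv cabsE conjc_real -cabsE mulfK//.
by rewrite rnormZ /cabs normrM normfV normr_id divff// mul1r.
Qed.

Lemma rdot_abs_le u v : `|rdot u v| <= rnorm u * rnorm v.
Proof. exact: le_trans (normr_Re_le _) (dot_le u v). Qed.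

Lemma rdot_ext u v : (forall w, rdot u w = rdot v w) -> u = v.
Proof.
move=> uv; apply/eqP; rewrite -subr_eq0; apply/eqP/rnorm_eq0/eqP.
by rewrite -sqrf_eq0 -rdotvv rdotBl uv subrr.
Qed.

(** The scalars [1] and [i] read off the real and imaginary parts. *)
Lemma dot_ext_Re u v w w' : (forall z, rdot (z *: u) v = rdot (z *: w) w') ->
  dot H u v = dot H w w'.
Proof.
move=> E; have := E 1; have := E 'i%C; rewrite !scale1r /rdot !dotZl.
by case: (dot H u v) (dot H w w') => a b [c d]; simpc => /= [/oppr_inj-> ->].
Qed.

Lemma hilbert_complete (u_ : nat -> H) :
  (forall e : R, 0 < e -> exists N, forall m n, (N <= m)%N -> (N <= n)%N ->
     rnorm (u_ m - u_ n) < e) ->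
  exists l, forall e : R, 0 < e -> exists N, forall n, (N <= n)%N ->
     rnorm (u_ n - l) < e.
Proof.
move=> uC; have : cvg (u_ @ \oo).
  apply/cauchy_cvgP/cauchy_exP => e e0.
  have eE : e = (complex.Re e)%:C by rewrite RRe_real// gtr0_real.
  have [|N NP] := uC (complex.Re e); first by rewrite -ltcR -eE.
  exists (u_ N); exists N => // n /= Nn.
  by rewrite -ball_normE/= normE eE ltcR NP.
move=> /cvg_ex[l lP]; exists l => e e0.
have /cvgrPdist_lt/(_ e%:C) := lP; rewrite ltcR => /(_ e0)[N _ NP].
by exists N => n Nn; rewrite rnorm_distC -ltcR -normE; exact: NP.
Qed.

Lemma bounded_opP T : bounded_op T <->
  linear T /\ exists2 M : R, 0 <= M & forall v, rnorm (T v) <= M * rnorm v.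
Proof.
split=> -[linT]; pose L := HB.pack T (GRing.isLinear.Build _ _ _ _ T linT) : {linear H -> H}.
  move=> /(@linear_bounded_continuous _ _ _ L)/linear_boundedP/pinfty_ex_gt0[r r0 rP].
  split=> //; have rE : r = (complex.Re r)%:C by rewrite RRe_real// gtr0_real.
  exists (complex.Re r) => [|v]; first by rewrite -lecR -rE ltW.
  by rewrite -lecR rmorphM/= -rE -!normE; exact: rP.
move=> [M M0 MP]; split=> //.
apply/(@linear_bounded_continuous _ _ _ L)/linear_boundedP; exists M%:C.
split; first by rewrite complex_real.
move=> r Mr v; rewrite (@le_trans _ _ (M%:C * `|v|))//.
  by rewrite !normE -rmorphM/= lecR MP.
by rewrite ler_wpM2r// ltW.
Qed.
End Hilbert.

(** * Coercive operators *)

Section Coercive.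
Local Open Scope complex_scope.
Variables (R : realType) (X : Type) (H : rkhs R X).
Implicit Types (u v w : H) (a b z : R[i]) (T S B : H -> H).

Section LinearMap.
Variables (T : H -> H) (linT : linear T).

Lemma linmapD u v : T (u + v) = T u + T v.
Proof. by have := linT 1 u v; rewrite !scale1r. Qed.

Lemma linmap0 : T 0 = 0.
Proof. by apply: (addrI (T 0)); rewrite -linmapD !addr0. Qed.

Lemma linmapZ z u : T (z *: u) = z *: T u.
Proof. by have := linT z u 0; rewrite !addr0 linmap0 addr0. Qed.

Lemma linmapB u v : T (u - v) = T u - T v.
Proof. by rewrite -[- v]scaleN1r linmapD linmapZ scaleN1r. Qed.

End LinearMap.

Lemma natSinv_lt (e : R) : 0 < e -> exists N, forall n, (N <= n)%N -> n.+1%:R^-1 < e.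
Proof.
by move=> e0; have [N _ NP] := near_infty_natSinv_lt (PosNum e0); exists N.
Qed.

(* [q + 1] instead of the sharp [q] avoids the degenerate case [q = 0]. *)
Lemma discr_le (q b e : R) : 0 <= q ->
  (forall t : R, 0 <= q * t ^+ 2 + 2 * b * t + e) -> b ^+ 2 <= (q + 1) * e.
Proof.
move=> q0 /(_ (- (b / (q + 1)))) h.
have q1 : 0 < q + 1 by lra.
have : 0 <= (q + 1) * (b / (q + 1)) ^+ 2 - 2 * b * (b / (q + 1)) + e.
  apply: le_trans h _; rewrite sqrrN mulrN !lerD2r ler_wpM2r ?sqr_ge0//; lra.
have -> : (q + 1) * (b / (q + 1)) ^+ 2 - 2 * b * (b / (q + 1)) + e =
    e - b ^+ 2 / (q + 1) by field; rewrite gt_eqF.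
by rewrite subr_ge0 ler_pdivrMr// mulrC.
Qed.

(** Completing the square; this bounds the energy [F] below, with [k] the norm of its argument. *)
Lemma mulr_square_bound (c K k : R) : 0 < c -> - (K ^+ 2 / c) <= c * k ^+ 2 - 2 * (K * k).
Proof.
move=> c0; rewrite -subr_ge0.
have -> : c * k ^+ 2 - 2 * (K * k) - - (K ^+ 2 / c) = (c * k - K) ^+ 2 / c.
  by field; rewrite gt_eqF.
by rewrite divr_ge0 ?sqr_ge0 ?ltW.
Qed.

Section Minimization.
Variables (B : H -> H) (linB : linear B) (L : R) (L0 : 0 <= L).
Variables (BL : forall v, rnorm (B v) <= L * rnorm v).
Variables (Bsym : forall u v, rdot (B u) v = rdot u (B v)).
Variables (c : R) (c0 : 0 < c) (Bc : forall v, c * rnorm v ^+ 2 <= rdot (B v) v).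
Variables (phi : H -> R) (phiD : forall u v, phi (u + v) = phi u + phi v).
Variables (phiZ : forall (r : R) u, phi (r%:C *: u) = r * phi u).
Variables (K : R) (phiK : forall v, phi v <= K * rnorm v).

(** Energy functional: its first variation vanishes at [u] exactly when [rdot (B u) w = phi w] for
    all [w]. *)
Let F u := rdot (B u) u - 2 * phi u.

Let F_add u w (t : R) : F (u + t%:C *: w) =
  F u + (rdot (B w) w * t ^+ 2 + 2 * (rdot (B u) w - phi w) * t).
Proof.
rewrite /F linmapD// linmapZ// phiD phiZ !rdotDl !rdotDr !rdotZl !rdotZr.
rewrite (rdotC (B w) u) -Bsym; ring.
Qed.

Let F_bounded : has_inf [set F u | u in setT].
Proof.
split; first by exists (F 0); exists 0.
exists (- (K ^+ 2 / c)) => _ [u _ <-].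
rewrite (le_trans (mulr_square_bound K (rnorm u) c0))//.
by rewrite /F lerB ?Bc// ler_wpM2l// phiK.
Qed.

Let I := inf [set F u | u in setT].

Let F_ge u : I <= F u.
Proof. by apply: ge_inf; [exact: F_bounded.2 | exists u]. Qed.

(* Riesz representation for the inner product [rdot (B u) v]: a minimizing
   sequence of [F] is Cauchy by the parallelogram identity. *)
Lemma coercive_solve : exists u, forall w, rdot (B u) w = phi w.
Proof.
have minseq (n : nat) : exists u, F u < I + n.+1%:R^-1.
  have n0 : 0 < n.+1%:R^-1 :> R by rewrite invr_gt0.
  by have [_ [u _ <-]] := inf_adherent n0 F_bounded; exists u.
have [u_ uP] := choice minseq.
have B_ge0 v : 0 <= rdot (B v) v.
  by apply: le_trans (Bc v); rewrite mulr_ge0 ?sqr_ge0 ?ltW.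
have dist m n : c * rnorm (u_ m - u_ n) ^+ 2 <= 2 * (m.+1%:R^-1 + n.+1%:R^-1).
  apply: le_trans (Bc _) _.
  (* The midpoint of [u_ m] and [u_ n]: there [F] is at least [I], while both endpoints are nearly
     minimal. *)
  have := F_ge (u_ m + (- 2^-1)%:C *: (u_ m - u_ n)).
  have -> : u_ n = u_ m + (-1)%:C *: (u_ m - u_ n).
    by rewrite rmorphN rmorph1 scaleN1r opprB addrCA subrr addr0.
  have := uP n; have -> : F (u_ n) = F (u_ m + (-1)%:C *: (u_ m - u_ n)).
    by rewrite rmorphN rmorph1 scaleN1r opprB addrCA subrr addr0.
  have -> : u_ m - (u_ m + (-1)%:C *: (u_ m - u_ n)) = u_ m - u_ n.
    by rewrite rmorphN rmorph1 scaleN1r opprD addrA subrr add0r opprK.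
  rewrite !F_add; have := uP m; move: (u_ m - u_ n) => w.
  by move: (m.+1%:R^-1) (n.+1%:R^-1) (rdot (B w) w) (rdot _ _) => x y q d; lra.
have [e e0|u ulim] := @hilbert_complete _ _ H u_.
  have ec : 0 < c * e ^+ 2 / 4 by rewrite divr_gt0// mulr_gt0// exprn_gt0.
  have [N NP] := natSinv_lt ec; exists N => m n Nm Nn.
  rewrite -(ltr_pXn2r (n := 2)) ?nnegrE ?rnorm_ge0 ?(ltW e0)//.
  rewrite -(ltr_pM2l c0); apply: le_lt_trans (dist m n) _.
  have := NP m Nm; have := NP n Nn.
  by move: (m.+1%:R^-1) (n.+1%:R^-1) (e ^+ 2) => x y q; lra.
exists u => w; apply/eqP; rewrite -subr_eq0; apply/negP => /negP d0.
set d := _ - _ in d0.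
(* Along the line through [u_ n] in direction [w], [F] never falls below [F (u_ n) - n.+1^-1], so
   the discriminant forces a small linear coefficient. *)
have euler n : (rdot (B (u_ n)) w - phi w) ^+ 2 <= (rdot (B w) w + 1) * n.+1%:R^-1.
  apply: discr_le => // t; have := F_ge (u_ n + t%:C *: w).
  rewrite F_add; have := uP n; move: (n.+1%:R^-1) => x; lra.
(* For large [n] the residual at [u_ n] is smaller than [|d| / 2], and so is its distance from the
   residual [d] at the limit, which is absurd. *)
have d2 : 0 < d ^+ 2 by rewrite exprn_even_gt0//= d0.
have q1 : 0 < rdot (B w) w + 1 by rewrite ltr_wpDl.
have [N1 NP1] := natSinv_lt (divr_gt0 (divr_gt0 d2 (ltr0n R 4)) q1).
have Lw : 0 < 2 * (L * rnorm w + 1) by have := mulr_ge0 L0 (rnorm_ge0 w); lra.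
have dn : 0 < `|d| by rewrite normr_gt0.
have [N2 NP2] := ulim _ (divr_gt0 dn Lw).
pose n := maxn N1 N2.
have {NP1} := NP1 n (leq_maxl _ _); rewrite ltr_pdivlMr// mulrC => h1.
have {NP2} := NP2 n (leq_maxr _ _); rewrite ltr_pdivlMr// => h2.
have h3 : `|rdot (B (u_ n)) w - phi w - d| <= L * rnorm w * rnorm (u_ n - u).
  rewrite /d opprB addrA subrK -rdotBl -linmapB//.
  apply: le_trans (rdot_abs_le _ _) _.
  by rewrite mulrAC ler_wpM2r ?rnorm_ge0.
have h4 : `|rdot (B (u_ n)) w - phi w| < `|d| / 2.
  rewrite -(ltr_pXn2r (n := 2)) ?nnegrE ?divr_ge0//.
  rewrite exprMn !real_normK ?num_real//; apply: le_lt_trans (euler n) _.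
  rewrite (_ : d ^+ 2 * 2^-1 ^+ 2 = d ^+ 2 / 4); first exact: h1.
  by field.
have := ler_normB (rdot (B (u_ n)) w - phi w) (rdot (B (u_ n)) w - phi w - d).
rewrite opprB addrCA subrr addr0 => h5.
have := rnorm_ge0 (u_ n - u).
move: (rnorm (u_ n - u)) (L * rnorm w) h2 h3 => k q h2 h3 k0.
nra.
Qed.

End Minimization.

End Coercive.

(** * Adjoints and spectrum *)

Section Operators.
Local Open Scope complex_scope.
Variables (R : realType) (X : Type) (H : rkhs R X).
Implicit Types (u v w : H) (a b z : R[i]) (A T S B : H -> H).

Lemma bounded_op_linear T : bounded_op T -> linear T.
Proof. by case. Qed.

Lemma bounded_op_bound T : bounded_op T ->
  exists2 M : R, 0 <= M & forall v, rnorm (T v) <= M * rnorm v.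
Proof. by case/bounded_opP. Qed.

Lemma bounded_op_comp T S : bounded_op T -> bounded_op S -> bounded_op (T \o S).
Proof.
case/bounded_opP=> linT [M M0 MP] /bounded_opP[linS [L L0 LP]].
apply/bounded_opP; split.
  by move=> a u v /=; rewrite linS linT.
exists (M * L) => [|v]; first exact: mulr_ge0.
by rewrite (le_trans (MP _))// -mulrA ler_wpM2l.
Qed.

Lemma bounded_op_addZ T S z : bounded_op T -> bounded_op S ->
  bounded_op (fun v => T v + z *: S v).
Proof.
case/bounded_opP=> linT [M M0 MP] /bounded_opP[linS [L L0 LP]].
apply/bounded_opP; split.
  move=> a u v /=; rewrite linS linT !scalerDr !scalerA (mulrC z).
  by rewrite addrACA.
exists (M + cabs z * L) => [|v]; first by rewrite addr_ge0 ?mulr_ge0 ?cabs_ge0.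
rewrite (le_trans (rnormD _ _))// mulrDl lerD// rnormZ -mulrA ler_wpM2l//.
exact: cabs_ge0.
Qed.

Lemma bounded_op_id : bounded_op (@id H).
Proof.
by apply/bounded_opP; split => //; exists 1 => // v; rewrite mul1r.
Qed.

Lemma bounded_op_0 : bounded_op (fun _ : H => 0 : H).
Proof.
apply/bounded_opP; split => [a u v|]; first by rewrite scaler0 addr0.
by exists 0 => // v; rewrite rnorm0 mul0r.
Qed.

Lemma bounded_opZ T z : bounded_op T -> bounded_op (fun v => z *: T v).
Proof.
move=> /(bounded_op_addZ z bounded_op_0); congr bounded_op.
by apply/funext => v; rewrite add0r.
Qed.

Lemma bounded_op_shift T z : bounded_op T -> bounded_op (fun v => T v - z *: v).
Proof.
move=> bT; have := bounded_op_addZ (- z) bT bounded_op_id.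
by under eq_fun do rewrite scaleNr.
Qed.

Lemma dot_ext u v : (forall w, dot H w u = dot H w v) -> u = v.
Proof. by move=> E; apply: rdot_ext => w; rewrite !(rdotC _ w) /rdot E. Qed.

(** Riesz representation is [coercive_solve] for the identity and the functional
    [u |-> rdot (A u) v]. It yields real parts only; the complex identity follows since [A] commutes
    with complex scalars. *)
Lemma adjoint_exists A : bounded_op A ->
  exists S, bounded_op S /\ forall u v, dot H (A u) v = dot H u (S v).
Proof.
case/bounded_opP=> linA [M M0 MP].
have riesz v : exists w, forall u, rdot w u = rdot (A u) v.
  apply: (@coercive_solve _ _ _ id _ 1 _ _ _ 1 _ _ _ _ _ (M * rnorm v)) => //.
  - by move=> u; rewrite mul1r.
  - by move=> u; rewrite mul1r rdotvv.
  - by move=> u w; rewrite linmapD// rdotDl.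
  - by move=> r u; rewrite linmapZ// rdotZl.
  - move=> u; rewrite (le_trans (rdot_le _ _))// mulrAC ler_wpM2r ?rnorm_ge0//.
have [S SP] := choice riesz; exists S.
have SE u v : dot H (A u) v = dot H u (S v).
  by apply: dot_ext_Re => z; rewrite -linmapZ// -SP rdotC.
split=> //; apply/bounded_opP; split.
  move=> a u v; apply: dot_ext => w.
  by rewrite -SE !linearDr /= !dotZr -!SE.
exists M => // v.
(* The square of [|S v|] is [rdot (A (S v)) v], so one factor [|S v|] cancels. *)
have [->|Sv0] := eqVneq (S v) 0; first by rewrite rnorm0 mulr_ge0 ?rnorm_ge0.
rewrite -(ler_pM2l (rnorm_gt0 Sv0)) -expr2 -rdotvv SP.
rewrite (le_trans (rdot_le _ _))// mulrA ler_wpM2r ?rnorm_ge0// mulrC.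
exact: MP.
Qed.

Lemma adjointP A : bounded_op A -> bounded_op (adjoint A) /\
  forall u v, dot H (A u) v = dot H u (adjoint A v).
Proof. by move/adjoint_exists; rewrite /adjoint; exact: getPex. Qed.

Definition selfadjoint T :=
  bounded_op T /\ forall u v, dot H (T u) v = dot H u (T v).

Lemma selfadjoint_adjoint_comp A : bounded_op A -> selfadjoint (adjoint A \o A).
Proof.
move=> bA; have [bS SE] := adjointP bA; split; first exact: bounded_op_comp.
by move=> u v /=; rewrite -SE dotC -SE -dotC.
Qed.

Lemma rdot_adjoint_comp A v : bounded_op A ->
  rdot ((adjoint A \o A) v) v = rnorm (A v) ^+ 2.
Proof.
by move=> bA; have [_ SE] := adjointP bA; rewrite rdotC /= /rdot -SE -rdotvv.
Qed.

Lemma selfadjoint_rdot T : selfadjoint T ->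
  forall u v, rdot (T u) v = rdot u (T v).
Proof. by move=> [_ sT] u v; rewrite /rdot sT. Qed.

(** Surjectivity is [coercive_solve] for the functionals [rdot y]; coercivity and Cauchy-Schwarz
    give [c |v| <= |B v|], hence injectivity and the bound [c^-1] for the inverse. *)
Lemma coercive_invertible B (c : R) : bounded_op B ->
  (forall u v, rdot (B u) v = rdot u (B v)) -> 0 < c ->
  (forall v, c * rnorm v ^+ 2 <= rdot (B v) v) ->
  exists S, [/\ bounded_op S, cancel B S & cancel S B].
Proof.
case/bounded_opP=> linB [M M0 MP] Bsym c0 Bc.
have solve y : exists u, B u = y.
  have [|||u uP] := @coercive_solve _ _ _ B linB M M0 MP Bsym c c0 Bc (rdot y) _ _ (rnorm y).
  - by move=> u w; rewrite rdotDr.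
  - by move=> r u; rewrite rdotZr.
  - by move=> u; exact: rdot_le.
  by exists u; apply: rdot_ext.
have [S BS] := choice solve; exists S.
have below v : c * rnorm v <= rnorm (B v).
  have [->|v0] := eqVneq v 0; first by rewrite rnorm0 mulr0 rnorm_ge0.
  rewrite -(ler_pM2r (rnorm_gt0 v0)) -mulrA -expr2 (le_trans (Bc v))//.
  exact: rdot_le.
have Binj : injective B.
  move=> u v uv; apply/eqP; rewrite -subr_eq0; apply/eqP/rnorm_eq0.
  have := below (u - v); rewrite linmapB// uv subrr rnorm0 pmulr_rle0// => h.
  by apply/eqP; rewrite eq_le h rnorm_ge0.
split=> //; last by move=> v; apply: Binj; rewrite BS.
apply/bounded_opP; split.
  by move=> a u v; apply: Binj; rewrite linB !BS.
exists c^-1 => [|v]; first by rewrite invr_ge0 ltW.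
by rewrite ler_pdivlMl// -{2}(BS v).
Qed.

(** For [t < 0] the operator [T - t] is coercive, and for [t > M] the operator [t - T] is; either
    way [T - t] is invertible. *)
Lemma spectrum_bounds T (M t : R) : selfadjoint T ->
  (forall v, 0 <= rdot (T v) v <= M * rnorm v ^+ 2) ->
  spectrum T t%:C -> 0 <= t <= M.
Proof.
move=> saT TM sp; have [bT _] := saT; have Tsym := selfadjoint_rdot saT.
rewrite leNgt (leNgt t); apply/andP; split; apply/negP => tb; apply: sp.
  apply: (@coercive_invertible _ (- t)).
  - exact: bounded_op_shift.
  - by move=> u v; rewrite rdotBl rdotBr rdotZl rdotZr Tsym.
  - by rewrite oppr_gt0.
  - move=> v; have /andP[+ _] := TM v; rewrite rdotBl rdotZl rdotvv.
    by rewrite mulNr; lra.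
have [||||S [bS c1 c2]] := @coercive_invertible (fun v => (-1 : R)%:C *: (T v - t%:C *: v)) (t - M).
- exact/bounded_opZ/bounded_op_shift.
- by move=> u v; rewrite rdotZl rdotZr rdotBl rdotBr rdotZl rdotZr Tsym.
- by rewrite subr_gt0.
- move=> v; have /andP[_] := TM v; rewrite rdotZl rdotBl rdotZl rdotvv.
  by rewrite mulrBl mulN1r opprB lerD2l lerN2.
exists (fun v => S ((-1 : R)%:C *: v)); split.
- exact: bounded_op_comp bS (bounded_opZ _ bounded_op_id).
- by move=> v; rewrite c1.
- move=> v; have := c2 ((-1 : R)%:C *: v).
  by rewrite rmorphN rmorph1 !scaleN1r => /oppr_inj.
Qed.

End Operators.

(** * Polynomials of a self-adjoint operator *)

Section PolynomialCalculus.
Local Open Scope complex_scope.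
Variables (R : realType) (X : Type) (H : rkhs R X).
Implicit Types (u v w : H) (a b z : R[i]) (A T S B : H -> H).
Implicit Types (r : {poly R[i]}) (p q : {poly R}).

(** The analogue of [op_horner] with complex coefficients, over which polynomials split into linear
    factors. *)
Definition cpoly_op r T v : H := \sum_(i < size r) r`_i *: iter i T v.

Lemma cpoly_op_wide n r T v : (size r <= n)%N ->
  cpoly_op r T v = \sum_(i < n) r`_i *: iter i T v.
Proof.
move=> rn; rewrite /cpoly_op -!(big_mkord xpredT (fun i => r`_i *: iter i T v)).
rewrite [RHS](big_cat_nat (n := size r))//= [X in _ + X]big_nat_cond.
rewrite [X in _ + X]big1 ?addr0// => i /andP[/andP[ri _] _].
by rewrite nth_default// scale0r.
Qed.

Lemma cpoly_opD r r' T v : cpoly_op (r + r') T v = cpoly_op r T v + cpoly_op r' T v.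
Proof.
pose n := maxn (size (r + r')) (maxn (size r) (size r')).
rewrite !(@cpoly_op_wide n) ?leq_max ?leqnn ?orbT// -big_split/=.
by apply: eq_bigr => i _; rewrite coefD scalerDl.
Qed.

Lemma cpoly_opZ a r T v : cpoly_op (a *: r) T v = a *: cpoly_op r T v.
Proof.
rewrite !(@cpoly_op_wide (size r)) ?size_scale_leq// scaler_sumr.
by apply: eq_bigr => i _; rewrite coefZ scalerA.
Qed.

Lemma cpoly_opC a T v : cpoly_op a%:P T v = a *: v.
Proof. by rewrite (@cpoly_op_wide 1) ?size_polyC_leq1// big_ord1 coefC. Qed.

Lemma cpoly_opMX r T v : cpoly_op (r * 'X) T v = cpoly_op r T (T v).
Proof.
rewrite (@cpoly_op_wide (size r).+1) ?(leq_trans (size_polyMleq _ _)) ?size_polyX ?addn2//.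
rewrite big_ord_recl coefMX/= scale0r add0r.
by apply: eq_bigr => i _; rewrite coefMX/= -iterSr.
Qed.

Lemma cpoly_opMXaddC r a T v :
  cpoly_op (r * 'X + a%:P) T v = cpoly_op r T (T v) + a *: v.
Proof. by rewrite cpoly_opD cpoly_opMX cpoly_opC. Qed.

Lemma cpoly_opXsubC a T v : cpoly_op ('X - a%:P) T v = T v - a *: v.
Proof.
by rewrite -(mul1r 'X) -polyCN cpoly_opMXaddC cpoly_opC scale1r scaleNr.
Qed.

Lemma cpoly_op0 T v : cpoly_op 0 T v = 0.
Proof. by rewrite /cpoly_op size_poly0 big_ord0. Qed.

Lemma cpoly_op_comm r T v : linear T -> T (cpoly_op r T v) = cpoly_op r T (T v).
Proof.
move=> linT; elim/poly_ind: r v => [|r a IH] v; first by rewrite !cpoly_op0 linmap0.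
by rewrite !cpoly_opMXaddC linmapD// linmapZ// IH.
Qed.

Lemma cpoly_opM r r' T v : linear T ->
  cpoly_op (r * r') T v = cpoly_op r T (cpoly_op r' T v).
Proof.
move=> linT; elim/poly_ind: r v => [|r a IH] v; first by rewrite mul0r !cpoly_op0.
rewrite mulrDl -mulrA (mulrC 'X) mulrA mul_polyC cpoly_opD cpoly_opMX cpoly_opZ.
by rewrite IH cpoly_opMXaddC cpoly_op_comm.
Qed.

Lemma bounded_cpoly_op r T : bounded_op T -> bounded_op (cpoly_op r T).
Proof.
move=> bT; elim/poly_ind: r => [|r a IH].
  by rewrite (funext (cpoly_op0 T)); exact: bounded_op_0.
rewrite (funext (cpoly_opMXaddC r a T)).
exact: bounded_op_addZ a (bounded_op_comp IH bT) (@bounded_op_id _ _ H).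

Qed.

Definition bounded_below T := exists2 c : R, 0 < c & forall v, c * rnorm v <= rnorm (T v).

(** Split [r] into linear factors: the operator is then a nonzero multiple of a product of operators
    [T - z], and lower bounds multiply. *)
Lemma cpoly_op_bounded_below r T : linear T -> r != 0 ->
  (forall z, root r z -> bounded_below (fun v => T v - z *: v)) ->
  bounded_below (cpoly_op r T).
Proof.
move=> linT r0; have [rs rE] := closed_field_poly_normal r.
have l0 : lead_coef r != 0 by rewrite lead_coef_eq0.
move=> below; have {}below z : z \in rs -> bounded_below (fun v => T v - z *: v).
  by move=> zrs; apply: below; rewrite rE rootZ// root_prod_XsubC.
have [c c0 cP] : bounded_below (cpoly_op (\prod_(z <- rs) ('X - z%:P)) T).
  elim: rs {rE} below => [|z rs IH] below.
    by rewrite big_nil; exists 1 => // v; rewrite cpoly_opC scale1r mul1r.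
  have [|c c0 cP] := IH; first by move=> y yrs; apply: below; rewrite inE yrs orbT.
  have [d d0 dP] := below z (mem_head _ _).
  exists (d * c) => [|v]; first exact: mulr_gt0.
  rewrite big_cons cpoly_opM// cpoly_opXsubC.
  by rewrite (le_trans _ (dP _))// -mulrA ler_pM2l.
exists (cabs (lead_coef r) * c) => [|v].
  by rewrite mulr_gt0// -ltcR -cabsE normr_gt0.
by rewrite rE cpoly_opZ -rE rnormZ -mulrA ler_wpM2l ?cabs_ge0.
Qed.

Lemma not_spectrum_bounded_below T z : ~ spectrum T z ->
  bounded_below (fun v => T v - z *: v).
Proof.
move=> /contrapT[S [/bounded_op_bound[M M0 MP] TS _]].
(* The bound [M] of the inverse may be zero; [M + 1] can be inverted. *)
have M1 : 0 < M + 1 by rewrite ltr_wpDl.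
exists (M + 1)^-1 => [|v]; first by rewrite invr_gt0.
rewrite ler_pdivrMl// -[in leLHS](TS v) (le_trans (MP _))//.
by rewrite ler_wpM2r ?rnorm_ge0// lerDl.
Qed.

Lemma normr_Im_le z : `|complex.Im z| <= cabs z.
Proof.
have i1 : `|'i%C : R[i]| = 1 by rewrite normc_def/= expr0n/= add0r expr1n sqrtr1.
have -> : cabs z = cabs (z * 'i%C) by rewrite /cabs normrM i1 mulr1.
by rewrite -normrN -ReiNIm normr_Re_le.
Qed.

(** As [<T v, v>] is real, the imaginary part of [<(T - z) v, v>] is [- Im z |v| ^+ 2];
    Cauchy-Schwarz then bounds [|(T - z) v|] below. *)
Lemma selfadjoint_bounded_below T z : selfadjoint T -> complex.Im z != 0 ->
  bounded_below (fun v => T v - z *: v).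
Proof.
move=> [_ sT] z0; exists `|complex.Im z| => [|v]; first by rewrite normr_gt0.
have [->|v0] := eqVneq v 0; first by rewrite rnorm0 mulr0 rnorm_ge0.
rewrite -(ler_pM2r (rnorm_gt0 v0)); apply: le_trans (dot_le _ _).
apply: le_trans (normr_Im_le _).
have Tv0 : complex.Im (dot H (T v) v) = 0.
  have : dot H (T v) v = (dot H (T v) v)^*%C by rewrite -dotC sT.
  by case: (dot H (T v) v) => x y [] /= E; lra.
rewrite linearBl /= dotZl raddfB/= Tv0 sub0r normrN dot_norm normE -rmorphXn.
rewrite -mulrA -expr2; case: z {z0} => x y; simpc => /=.
by rewrite normrM (ger0_norm (sqr_ge0 _)).
Qed.

Lemma op_hornerE p T : op_horner p T = cpoly_op (map_poly (real_complex R) p) T.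
Proof.
apply/funext => v; rewrite /op_horner /cpoly_op size_map_poly.
by apply: eq_bigr => i _; rewrite coef_map.
Qed.

Lemma op_hornerC (c : R) T v : op_horner c%:P T v = c%:C *: v.
Proof. by rewrite op_hornerE map_polyC cpoly_opC. Qed.

Lemma op_hornerX T v : op_horner 'X T v = T v.
Proof.
by rewrite op_hornerE map_polyX -(mul1r 'X) cpoly_opMX cpoly_opC scale1r.
Qed.

Lemma op_hornerD p q T v : op_horner (p + q) T v = op_horner p T v + op_horner q T v.
Proof. by rewrite !op_hornerE rmorphD cpoly_opD. Qed.

Lemma op_hornerB p q T v : op_horner (p - q) T v = op_horner p T v - op_horner q T v.
Proof.
by rewrite !op_hornerE rmorphB cpoly_opD -scaleN1r cpoly_opZ scaleN1r.
Qed.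

Lemma op_hornerM p q T v : linear T ->
  op_horner (p * q) T v = op_horner p T (op_horner q T v).
Proof. by move=> linT; rewrite !op_hornerE rmorphM cpoly_opM. Qed.

Lemma bounded_op_horner p T : bounded_op T -> bounded_op (op_horner p T).
Proof. by rewrite op_hornerE; exact: bounded_cpoly_op. Qed.

Lemma selfadjoint_op_horner p T : selfadjoint T -> selfadjoint (op_horner p T).
Proof.
move=> [bT sT]; split; first exact: bounded_op_horner.
have linT := bounded_op_linear bT.
elim/poly_ind: p => [|p c IH] u v.
  by rewrite !op_hornerE map_poly0 !cpoly_op0 linear0l linear0r.
rewrite !op_hornerD !op_hornerM// !op_hornerX !op_hornerC.
rewrite linearDl linearDr /= dotZl dotZr conjc_real; congr (_ + _).
by rewrite IH sT op_hornerE cpoly_op_comm.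
Qed.

Lemma operator_norm T : bounded_op T -> exists K : R, [/\ 0 <= K,
  forall v, rnorm (T v) <= K * rnorm v &
  forall k : R, 0 <= k -> (forall v, rnorm (T v) <= k * rnorm v) -> K <= k].
Proof.
case/bounded_op_bound=> M M0 MP.
pose E := [set k : R | 0 <= k /\ forall v, rnorm (T v) <= k * rnorm v].
have E0 : E !=set0 by exists M.
have Elb : lbound E 0 by move=> k [].
exists (inf E); split.
- exact: lb_le_inf.
- move=> v; have [->|v0] := eqVneq v 0.
    by have := MP 0; rewrite rnorm0 !mulr0.
  rewrite -ler_pdivrMr ?rnorm_gt0//; apply: lb_le_inf => // k [_ kP].
  by rewrite ler_pdivrMr ?rnorm_gt0.
- by move=> k k0 kP; apply: ge_inf; [exists 0|split].
Qed.

(* For self-adjoint [B] of norm [K], [B ^+ 2 - K ^+ 2] nearly annihilates the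
   vectors on which [B] nearly attains its norm. *)
Lemma sqr_norm_not_bounded_below B (K : R) (v0 : H) : v0 != 0 -> selfadjoint B ->
  0 <= K -> (forall v, rnorm (B v) <= K * rnorm v) ->
  (forall k : R, 0 <= k -> (forall v, rnorm (B v) <= k * rnorm v) -> K <= k) ->
  ~ bounded_below (fun v => B (B v) - (K ^+ 2)%:C *: v).
Proof.
move=> v0N0 saB K0 KP Kmin [c c0 cP]; have Bsym := selfadjoint_rdot saB.
(* Expand the square of [|B (B v) - K ^+ 2 v|] and use [|B (B v)| <= K |B v|]. *)
have key v : c ^+ 2 * rnorm v ^+ 2 <= K ^+ 2 * (K ^+ 2 * rnorm v ^+ 2 - rnorm (B v) ^+ 2).
  have : (c * rnorm v) ^+ 2 <= rnorm (B (B v) - (K ^+ 2)%:C *: v) ^+ 2.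
    by rewrite lerXn2r ?nnegrE ?mulr_ge0 ?rnorm_ge0 ?(ltW c0)//.
  rewrite -rdotvv rdotBl !rdotBr !rdotZl !rdotZr (rdotC v (B (B v))) (Bsym (B v) v) !rdotvv.
  have : rnorm (B (B v)) ^+ 2 <= (K * rnorm (B v)) ^+ 2.
    by rewrite lerXn2r ?nnegrE ?mulr_ge0 ?rnorm_ge0 ?KP.
  rewrite !exprMn; nra.
have n0 : 0 < rnorm v0 ^+ 2 by rewrite exprn_gt0// rnorm_gt0.
have c20 : 0 < c ^+ 2 by rewrite exprn_gt0.
have KN0 : 0 < K.
  rewrite lt_neqAle K0 andbT; apply/eqP => KE; have := key v0.
  by rewrite -KE expr0n/= !mul0r leNgt mulr_gt0.
have K20 : 0 < K ^+ 2 by rewrite exprn_gt0.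
(* By [key], [Num.sqrt s] is again a bound for [B], yet it is strictly below the least bound [K]. *)
pose s := K ^+ 2 - c ^+ 2 / K ^+ 2.
have sP v : rnorm (B v) ^+ 2 <= s * rnorm v ^+ 2.
  have := key v; rewrite -ler_pdivrMl// /s mulrBl mulrA => h.
  rewrite (mulrC (c ^+ 2)); lra.
have s0 : 0 <= s.
  by rewrite -(pmulr_lge0 _ n0) (le_trans _ (sP v0))// sqr_ge0.
have : K <= Num.sqrt s.
  apply: Kmin => [|v]; first exact: sqrtr_ge0.
  rewrite -(ler_pXn2r (n := 2)) ?nnegrE ?mulr_ge0 ?rnorm_ge0 ?sqrtr_ge0//.
  by rewrite exprMn sqr_sqrtr.
rewrite -(ler_pXn2r (n := 2)) ?nnegrE ?sqrtr_ge0// sqr_sqrtr//.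
by rewrite /s lerDl oppr_ge0 leNgt divr_gt0.
Qed.

Lemma op_horner_norm_nonconst T q (v0 : H) : v0 != 0 -> selfadjoint T ->
  (1 < size q)%N -> exists2 t : R, spectrum T t%:C &
    forall v, rnorm (op_horner q T v) <= `|q.[t]| * rnorm v.
Proof.
move=> v0N0 saT qsize; have [bT _] := saT; have linT := bounded_op_linear bT.
have saB := selfadjoint_op_horner q saT.
have [K [K0 KP Kmin]] := operator_norm saB.1.
suff [t st tE] : exists2 t : R, spectrum T t%:C & q.[t] ^+ 2 = K ^+ 2.
  exists t => // v; rewrite (_ : `|_| = K) ?KP//.
  by apply/eqP; rewrite -(eqrXn2 (n := 2))// real_normK ?num_real// tE.
apply: contrapT => noroot.
apply: (sqr_norm_not_bounded_below v0N0 saB K0 KP Kmin).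
pose r := q * q - (K ^+ 2)%:P.
have rE : op_horner r T = fun v => op_horner q T (op_horner q T v) - (K ^+ 2)%:C *: v.
  by apply/funext => v; rewrite op_hornerB op_hornerM// op_hornerC.
rewrite -rE op_hornerE; apply: cpoly_op_bounded_below => //.
  (* [q * q] is not constant, so subtracting a constant leaves a nonzero polynomial. *)
  rewrite map_poly_eq0 -size_poly_eq0 size_polyDl.
    by rewrite size_mul -?size_poly_eq0; case: (size q) qsize => [|[|n]].
  rewrite size_polyN (leq_ltn_trans (size_polyC_leq1 _))//.
  by rewrite size_mul -?size_poly_eq0; case: (size q) qsize => [|[|n]]//; rewrite addnS.
move=> z rz; have [z0|z0] := eqVneq (complex.Im z) 0; last exact: selfadjoint_bounded_below.
have zE : z = (complex.Re z)%:C by case: z z0 {rz} => x y /= ->.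
rewrite zE in rz *; apply: not_spectrum_bounded_below => st.
apply: noroot; exists (complex.Re z) => //.
move: rz; rewrite fmorph_root /root !hornerE subr_eq0 -expr2 => /eqP.
by [].
Qed.

(* The vector [v0] excludes the zero space, where the spectrum is empty. *)
Lemma op_horner_norm T q (v0 : H) : v0 != 0 -> selfadjoint T ->
  exists2 t : R, spectrum T t%:C &
    forall v, rnorm (op_horner q T v) <= `|q.[t]| * rnorm v.
Proof.
move=> v0N0 saT; have [/size1_polyC qE|] := leqP (size q) 1; last first.
  exact: (op_horner_norm_nonconst v0N0 saT).
(* For constant [q] any point of the spectrum will do; the polynomial ['X] supplies one. *)
have [|t st _] := @op_horner_norm_nonconst T 'X v0 v0N0 saT; first by rewrite size_polyX.
by exists t => // v; rewrite qE op_hornerC hornerC rnormZr.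
Qed.

Lemma op_horner_le T q (d : R) : selfadjoint T ->
  (forall t : R, spectrum T t%:C -> `|q.[t]| <= d) ->
  forall v, rnorm (op_horner q T v) <= d * rnorm v.
Proof.
move=> saT qd v; have [->|v0] := eqVneq v 0.
  by rewrite (linmap0 (bounded_op_linear (bounded_op_horner q saT.1))) rnorm0 mulr0.
have [t st tP] := op_horner_norm q v0 saT.
by rewrite (le_trans (tP v))// ler_wpM2r ?rnorm_ge0 ?qd.
Qed.

End PolynomialCalculus.

(** * Continuous functional calculus *)

Lemma orlicz_convex_ineq (R : realType) (f : R -> R) (x y t : R) : is_orlicz f ->
  0 <= x -> 0 <= y -> 0 <= t <= 1 ->
  f (t * x + (1 - t) * y) <= t * f x + (1 - t) * f y.
Proof.
move=> of_ x0 y0 /andP[t0 t1].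
have := @orlicz_convex _ _ of_ (Itv01 t0 t1) x y.
by rewrite !convRE/=; apply; rewrite inE/= in_itv/= andbT.
Qed.

(** The slope is the supremum of the difference quotients to the left of [s], which by convexity are
    at most those to the right. At [s = 0] slope zero works, as [f] is nonnegative and [f 0 = 0]. *)
Lemma orlicz_support_line (R : realType) (f : R -> R) (s : R) : is_orlicz f ->
  0 <= s -> exists m : R, forall t, 0 <= t -> f s + m * (t - s) <= f t.
Proof.
move=> of_; rewrite le_eqVlt => /orP[/eqP <-|s0].
  by exists 0 => t t0; rewrite mul0r addr0 (orlicz0 of_) (orlicz_ge0 of_).
pose E := [set (f s - f r) / (s - r) | r in [set r | 0 <= r < s]].
have E0 : E !=set0 by exists ((f s - f 0) / (s - 0)); exists 0; rewrite //= lexx.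
have Eub t : s < t -> ubound E ((f t - f s) / (t - s)).
  move=> st _ [r /= /andP[r0 rs] <-].
  have ts : 0 < t - s by rewrite subr_gt0.
  have sr : 0 < s - r by rewrite subr_gt0.
  have tr : 0 < t - r by lra.
  rewrite ler_pdivrMr// mulrAC ler_pdivlMr//.
  (* The weight that writes [s] as a convex combination of [r] and [t]. *)
  have := @orlicz_convex_ineq _ f r t ((t - s) / (t - r)) of_ r0.
  have -> : (t - s) / (t - r) * r + (1 - (t - s) / (t - r)) * t = s.
    by field; rewrite gt_eqF.
  have t0 : 0 <= t by lra.
  have h01 : 0 <= (t - s) / (t - r) <= 1.
    by rewrite divr_ge0 ?(ltW ts) ?(ltW tr)//= ler_pdivrMr// mul1r; lra.
  move=> /(_ t0 h01).
  have -> : (t - s) / (t - r) * f r + (1 - (t - s) / (t - r)) * f t =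
    ((t - s) * f r + (s - r) * f t) / (t - r) by field; rewrite gt_eqF.
  by rewrite ler_pdivlMr//; lra.
have s1 : s < s + 1 by rewrite ltrDl.
exists (sup E) => t t0; have [ts|st|<-] := ltgtP t s; last by rewrite subrr mulr0 addr0.
- have : (f s - f t) / (s - t) <= sup E.
    apply: ub_le_sup; first by exists ((f (s + 1) - f s) / (s + 1 - s)); exact: Eub.
    by exists t; rewrite //= t0.
  by rewrite ler_pdivrMr ?subr_gt0//; lra.
- have : sup E <= (f t - f s) / (t - s) by apply: ge_sup => //; exact: Eub.
  by rewrite ler_pdivlMr ?subr_gt0//; lra.
Qed.

Section FunctionalCalculus.
Local Open Scope complex_scope.
Variables (R : realType) (X : Type) (H : rkhs R X).
Implicit Types (u v w : H) (A T S B : H -> H) (p q : {poly R}) (f : R -> R).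

Lemma is_cfcP f T S : is_cfc f T S <-> bounded_op S /\
  forall e : R, 0 < e -> exists2 d : R, 0 < d & forall p,
    (forall t : R, spectrum T t%:C -> `|p.[t] - f t| <= d) ->
    forall v, rnorm (S v - op_horner p T v) <= e * rnorm v.
Proof.
split=> -[bS SP]; split=> // e /SP[d d0 dP]; exists d => // p /dP pP v.
  by rewrite -lecR rmorphM/= -!normE.
by rewrite !normE -rmorphM/= lecR.
Qed.

Section Positive.
Variables (T : H -> H) (saT : selfadjoint T) (M : R) (M0 : 0 < M).
Hypothesis TM : forall v, 0 <= rdot (T v) v <= M * rnorm v ^+ 2.

Let spM t : spectrum T t%:C -> 0 <= t <= M.
Proof. exact: spectrum_bounds. Qed.

Let bT : bounded_op T. Proof. exact: saT.1. Qed.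

Let linT : linear T. Proof. exact: bounded_op_linear. Qed.

Lemma op_horner_segment_le p (d : R) : (forall t : R, 0 <= t <= M -> `|p.[t]| <= d) ->
  forall v, rnorm (op_horner p T v) <= d * rnorm v.
Proof. by move=> pd; apply: op_horner_le => // t /spM/pd. Qed.

Lemma cfc_approx f S : {within `[0, M], continuous f} -> is_cfc f T S ->
  forall e : R, 0 < e -> exists p, (forall t : R, 0 <= t <= M -> `|p.[t] - f t| <= e) /\
    forall v, rnorm (S v - op_horner p T v) <= e * rnorm v.
Proof.
move=> fc /is_cfcP[_ SP] e e0; have [d d0 dP] := SP e e0.
(* Tolerance [d] controls the operator distance and [e] the distance on the segment, so one
   polynomial serves for both. *)
have [|p pP] := @weierstrass _ M f M0 fc (Num.min d e); first by rewrite lt_min d0.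
exists p; split=> [t tM|].
  by rewrite (le_trans (pP t tM))// ge_min lexx orbT.
by apply: dP => t /spM tM; rewrite (le_trans (pP t tM))// ge_min lexx.
Qed.

(** [S] is the pointwise limit of [p_ n (T)] for Weierstrass approximants [p_ n]; the sequence is
    Cauchy because [|q(T)|] is at most the supremum of [|q|] on the segment. Passing to the limit,
    [d = e] works in the definition. *)
Lemma cfc_exists f : {within `[0, M], continuous f} -> exists S, is_cfc f T S.
Proof.
move=> fc.
have seqp (n : nat) : exists p, forall t : R, 0 <= t <= M -> `|p.[t] - f t| <= n.+1%:R^-1.
  by apply: weierstrass => //; rewrite invr_gt0.
have [p_ pP] := choice seqp.
have lim v : exists l, forall e : R, 0 < e -> exists N, forall n, (N <= n)%N ->
    rnorm (op_horner (p_ n) T v - l) < e.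
  apply: hilbert_complete => e e0.
  have v1 : 0 < 2 * (rnorm v + 1) by have := rnorm_ge0 v; lra.
  have [N NP] := natSinv_lt (divr_gt0 e0 v1).
  exists N => m n Nm Nn; rewrite -op_hornerB.
  have h : rnorm (op_horner (p_ m - p_ n) T v) <=
      (m.+1%:R^-1 + n.+1%:R^-1) * rnorm v.
    apply: op_horner_segment_le => t tM; rewrite hornerD hornerN.
    rewrite (le_trans (ler_distD (f t) _ _))// lerD ?pP// distrC pP//.
  apply: le_lt_trans h _.
  have arith (x y k : R) : 0 < x -> 0 < y -> x * (2 * (k + 1)) < e ->
    y * (2 * (k + 1)) < e -> (x + y) * k < e by lra.
  apply: arith.
  - by rewrite invr_gt0.
  - by rewrite invr_gt0.
  - by have := NP _ Nm; rewrite ltr_pdivlMr.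
  - by have := NP _ Nn; rewrite ltr_pdivlMr.
have [S SP] := choice lim; exists S.
have est (d : R) p : (forall t : R, spectrum T t%:C -> `|p.[t] - f t| <= d) ->
    forall v, rnorm (S v - op_horner p T v) <= d * rnorm v.
  move=> pd v; apply/ler_addgt0Pr => e e0.
  have e2 : 0 < e / 2 by rewrite divr_gt0.
  have [N1 NP1] := SP v _ e2.
  have v1 : 0 < rnorm v + 1 by have := rnorm_ge0 v; lra.
  have [N2 NP2] := natSinv_lt (divr_gt0 e2 v1).
  pose n := maxn N1 N2.
  have := NP1 n (leq_maxl _ _); have {NP2} := NP2 n (leq_maxr _ _).
  rewrite ltr_pdivlMr// => h1 h2.
  have h3 : rnorm (op_horner (p_ n - p) T v) <= (n.+1%:R^-1 + d) * rnorm v.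
    apply: op_horner_le => // t st; rewrite hornerD hornerN.
    by rewrite (le_trans (ler_distD (f t) _ _))// lerD ?pP ?spM// distrC pd.
  have := rnorm_distD (op_horner (p_ n) T v) (S v) (op_horner p T v).
  rewrite -op_hornerB (rnorm_distC _ (op_horner (p_ n) T v)) => h4.
  have arith (x k g : R) : 0 < x -> x * (k + 1) < e / 2 -> g < e / 2 ->
    g + (x + d) * k <= d * k + e by lra.
  apply: le_trans h4 _; apply: le_trans (lerD (lexx _) h3) _.
  by apply: arith; rewrite ?invr_gt0.
apply/is_cfcP; split; last by move=> e e0; exists e => // p; exact: est.
have approx n v : rnorm (S v - op_horner (p_ n) T v) <= n.+1%:R^-1 * rnorm v.
  by apply: est => t /spM; exact: pP.
apply/bounded_opP; split.
  (* Each [p_ n (T)] is linear, so the defect of linearity of [S] is at most a multiple of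
     [n.+1^-1]. *)
  move=> a u v; apply/eqP; rewrite -subr_eq0; apply/eqP/rnorm_eq0/eqP.
  rewrite eq_le rnorm_ge0 andbT; apply/ler_addgt0Pr => e e0; rewrite add0r.
  pose C := rnorm (a *: u + v) + cabs a * rnorm u + rnorm v + 1.
  have C0 : 0 < C.
    by rewrite ltr_wpDl// !addr_ge0 ?mulr_ge0 ?rnorm_ge0 ?cabs_ge0.
  have [n /(_ n (leqnn n))] := natSinv_lt (divr_gt0 e0 C0).
  rewrite ltr_pdivlMr// => h.
  have -> : S (a *: u + v) - (a *: S u + S v) =
      (S (a *: u + v) - op_horner (p_ n) T (a *: u + v)) -
      (a *: (S u - op_horner (p_ n) T u) + (S v - op_horner (p_ n) T v)).
    rewrite (bounded_op_linear (bounded_op_horner (p_ n) bT)).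
    by rewrite scalerBr addrACA -opprD [in RHS]opprB addrA subrK.
  apply: le_trans (rnormB _ _) _.
  apply: le_trans (lerD (approx n _) (rnormD _ _)) _.
  rewrite rnormZ.
  have h1 := lerD (ler_wpM2l (cabs_ge0 a) (approx n u)) (approx n v).
  apply: le_trans (lerD (lexx _) h1) (le_trans _ (ltW h)).
  have arith (x k1 k2 k3 k : R) : 0 < x ->
    x * k1 + (k * (x * k2) + x * k3) <= x * (k1 + k * k2 + k3 + 1) by lra.
  by apply: arith; rewrite invr_gt0.
(* [S] differs from [p_ 0 (T)] by norm at most [1], the tolerance at index zero. *)
have [L L0 LP] := bounded_op_bound (bounded_op_horner (p_ 0) bT).
exists (1 + L) => [|v]; first exact: addr_ge0.
rewrite -[S v](subrK (op_horner (p_ 0) T v)) mulrDl.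
by rewrite (le_trans (rnormD _ _))// lerD// -invr1; exact: approx.
Qed.

Lemma cfcP f : {within `[0, M], continuous f} -> is_cfc f T (cfc f T).
Proof. by move/cfc_exists; rewrite /cfc; exact: getPex. Qed.

(** For [p] near the square root on the segment, [S ^+ 2 - T] is the sum of [S (S - p(T))],
    [(S - p(T)) p(T)] and [(p ^+ 2 - 'X)(T)], all small. *)
Lemma cfc_sqrt_sqr S : is_cfc Num.sqrt T S -> S \o S = T.
Proof.
move=> cS; have fc : {within `[0, M], continuous (@Num.sqrt R)}.
  by apply: continuous_subspaceT; exact: sqrt_continuous.
have [bS _] := cS; have linS := bounded_op_linear bS.
have [L L0 LP] := bounded_op_bound bS.
apply/funext => v /=; apply/eqP; rewrite -subr_eq0; apply/eqP/rnorm_eq0/eqP.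
rewrite eq_le rnorm_ge0 andbT; apply/ler_addgt0Pr => e e0; rewrite add0r.
(* The coefficients of [d] in the three error terms, plus [1] for positivity. The cap [d <= 1] gives
   [|p + sqrt| <= 2 * Num.sqrt M + 1] on the segment and [|p(T)| <= L + 1]. *)
pose C := (2 * Num.sqrt M + 1 + L + (L + 1)) * rnorm v + 1.
have sM := sqrtr_ge0 M.
have C0 : 0 < C.
  by rewrite ltr_wpDl// mulr_ge0 ?rnorm_ge0//; lra.
pose d := Num.min 1 (e / C).
have d0 : 0 < d by rewrite lt_min ltr01 divr_gt0.
have d1 : d <= 1 by rewrite ge_min lexx.
have dC : d * C <= e by rewrite -ler_pdivlMr// ge_min lexx orbT.
have [p [pP pS]] := cfc_approx fc cS d0.
have h1 : rnorm (op_horner (p * p - 'X) T v) <= d * (2 * Num.sqrt M + 1) * rnorm v.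
  apply: op_horner_segment_le => t tM; have /andP[t0 tM'] := tM.
  have -> : (p * p - 'X).[t] = (p.[t] - Num.sqrt t) * (p.[t] + Num.sqrt t).
    by rewrite -subr_sqr sqr_sqrtr// !hornerE.
  rewrite normrM.
  rewrite ler_pM ?pP//.
  rewrite -[p.[t]](subrK (Num.sqrt t)) -addrA (le_trans (ler_normD _ _))//.
  rewrite [leRHS]addrC lerD// ?(le_trans (pP _ tM))//.
  rewrite ger0_norm ?addr_ge0 ?sqrtr_ge0// mulr2n mulrDl mul1r.
  by rewrite lerD// ler_sqrt// ltW.
have pv : rnorm (op_horner p T v) <= (L + 1) * rnorm v.
  rewrite -[op_horner p T v](subrK (S v)) (le_trans (rnormD _ _))//.
  rewrite mulrDl mul1r addrC lerD// rnorm_distC (le_trans (pS v))//.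
  by rewrite -[leRHS]mul1r ler_wpM2r ?rnorm_ge0.
have -> : S (S v) - T v = S (S v - op_horner p T v) +
    (S (op_horner p T v) - op_horner p T (op_horner p T v)) + op_horner (p * p - 'X) T v.
  rewrite (linmapB linS) op_hornerB op_hornerM// op_hornerX.
  by rewrite !subrKA.
apply: le_trans dC; rewrite /C mulrDr mulr1.
apply: le_trans (rnormD _ _) _; apply: le_trans (lerD (rnormD _ _) h1) _.
have h2 : rnorm (S (S v - op_horner p T v)) <= d * (L * rnorm v).
  by rewrite (le_trans (LP _))// mulrCA ler_wpM2l.
have h3 : rnorm (S (op_horner p T v) - op_horner p T (op_horner p T v)) <=
    d * ((L + 1) * rnorm v).
  by rewrite (le_trans (pS _))// ler_wpM2l// ltW.
lra.
Qed.

(* Operator Jensen inequality: [f - l] is nonnegative on the spectrum for the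
   supporting line [l] of [f] at [rdot (T v) v]. *)
Lemma cfc_jensen f S v : is_orlicz f -> is_cfc f T S -> rnorm v = 1 ->
  f (rdot (T v) v) <= rdot (S v) v.
Proof.
move=> of_ cS v1; set s := rdot (T v) v.
have fc : {within `[0, M], continuous f}.
  apply: continuous_subspaceW (orlicz_continuous of_).
  by apply: subset_itvl; rewrite bnd_simp.
have s0 : 0 <= s by case/andP: (TM v).
have [m mP] := orlicz_support_line of_ s0.
apply/ler_addgt0Pr => e e0; have e2 : 0 < e / 2 by rewrite divr_gt0.
have [p [pP pS]] := cfc_approx fc cS e2.
(* On the segment [p] minus the supporting line lies in [[- e / 2, C]]. Subtracting the midpoint of
   this interval gives [q], whose norm bound is the half-length, and midpoint minus half-length
   returns the lower bound [- e / 2]. *)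
pose C : R := f M + e / 2 - f s + m * s + `|m| * M.
pose q := p - (f s - m * s + (C - e / 2) / 2)%:P - m%:P * 'X.
have qP v' : rnorm (op_horner q T v') <= (C + e / 2) / 2 * rnorm v'.
  apply: op_horner_segment_le => t tM; have /andP[t0 tM'] := tM.
  rewrite /q !hornerE; have := pP t tM; rewrite !ler_norml => /andP[p1 p2].
  have := mP t t0.
  have : f t <= f M.
    by apply: (orlicz_nondecreasing of_); rewrite // in_itv/= ?t0 ?(ltW M0).
  have : - (m * t) <= `|m| * M.
    rewrite -mulNr (@le_trans _ _ (`|m| * t))//.
      by rewrite ler_wpM2r// -normrN ler_norm.
    by rewrite ler_wpM2l.
  rewrite mulrBr /C; lra.
have := le_trans (rdot_abs_le _ _) (ler_wpM2r (rnorm_ge0 v) (qP v)).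
rewrite v1 !mulr1 ler_norml => /andP[+ _].
rewrite !op_hornerB op_hornerM// !op_hornerC op_hornerX !rdotBl !rdotZl -/s.
rewrite rdotvv v1 expr1n mulr1.
have := le_trans (rdot_abs_le _ v) (ler_wpM2r (rnorm_ge0 v) (pS v)).
rewrite v1 !mulr1 rdotBl ler_norml => /andP[+ _].
lra.
Qed.

End Positive.
End FunctionalCalculus.

(** * Berezin number and norm *)

Section Berezin.
Local Open Scope complex_scope.
Variables (R : realType) (X : Type) (H : rkhs R X).
Hypothesis kernel_neq0 : forall x : X, kernel H x != 0.
Implicit Types (x y : X) (u v w : H) (A T S B : H -> H) (f : R -> R).

Lemma rnorm_nkernel x : rnorm (nkernel H x) = 1.
Proof.
have k0 := rnorm_gt0 (kernel_neq0 x).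
rewrite /nkernel normE -fmorphV rnormZr gtr0_norm ?invr_gt0//.
by rewrite mulVf// gt_eqF.
Qed.

(** [sup] is a genuine supremum only for sets bounded above. *)
Lemma ber_ubound T : bounded_op T -> has_ubound
  [set complex.Re `|dot H (T (nkernel H x)) (nkernel H x)| | x in [set: X]].
Proof.
case/bounded_op_bound=> M M0 MP; exists M => _ [x _ <-].
rewrite (le_trans (dot_le _ _))// rnorm_nkernel mulr1 (le_trans (MP _))//.
by rewrite rnorm_nkernel mulr1.
Qed.

Lemma le_ber T x : bounded_op T ->
  cabs (dot H (T (nkernel H x)) (nkernel H x)) <= ber T.
Proof. by move=> bT; apply: ub_le_sup; [exact: ber_ubound | exists x]. Qed.

Lemma le_ber_norm T x : bounded_op T ->
  cabs (dot H (T (nkernel H x)) (nkernel H x)) <= ber_norm T.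
Proof.
case/bounded_op_bound=> M M0 MP; apply: ub_le_sup; last by exists (x, x).
exists M => _ [xy _ <-].
rewrite (le_trans (dot_le _ _))// rnorm_nkernel mulr1 (le_trans (MP _))//.
by rewrite rnorm_nkernel mulr1.
Qed.

Lemma rdot_le_ber_norm T x : bounded_op T ->
  rdot (T (nkernel H x)) (nkernel H x) <= ber_norm T.
Proof.
move=> bT; apply: le_trans (le_ber_norm x bT).
exact: le_trans (ler_norm _) (normr_Re_le _).
Qed.

Hypothesis X_nonempty : inhabited X.

Lemma ber_le T (c : R) :
  (forall x, cabs (dot H (T (nkernel H x)) (nkernel H x)) <= c) -> ber T <= c.
Proof.
move=> Tc; case: X_nonempty => x0; apply: ge_sup => [|_ [x _ <-]]; last exact: Tc.
by exists (complex.Re `|dot H (T (nkernel H x0)) (nkernel H x0)|); exists x0.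
Qed.

Lemma ber_ge0 T : bounded_op T -> 0 <= ber T.
Proof.
by move=> bT; case: X_nonempty => x; apply: le_trans (le_ber x bT); exact: cabs_ge0.
Qed.

(** If [c < f (ber T ^+ 2)], continuity of [f] keeps every kernel value a fixed distance below
    [ber T], against its being the supremum. *)
Lemma orlicz_ber_le f T (c : R) : is_orlicz f -> bounded_op T ->
  (forall x, f (cabs (dot H (T (nkernel H x)) (nkernel H x)) ^+ 2) <= c) ->
  f (ber T ^+ 2) <= c.
Proof.
move=> of_ bT Tc; rewrite leNgt; apply/negP; rewrite -subr_gt0 => e0.
have b0 := ber_ge0 bT.
have b2 : [set` `[0, +oo[] (ber T ^+ 2) by rewrite /= in_itv/= andbT sqr_ge0.
have [d d0 dP] := within_continuous_dist (orlicz_continuous of_) b2 e0.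
(* [2 * ber T + 1] exceeds [ber T + k], the factor between differences of squares and differences,
   and is positive even when [ber T = 0]. *)
have b1 : 0 < 2 * ber T + 1 by lra.
have : ber T - d / (2 * ber T + 1) < ber T by rewrite gtrBl divr_gt0.
apply/negP; rewrite -leNgt; apply: ber_le => x.
rewrite leNgt; apply/negP; set k := cabs _ => kb.
have k0 : 0 <= k by exact: cabs_ge0.
have kb' : k <= ber T by exact: le_ber.
have kd : `|ber T ^+ 2 - k ^+ 2| < d.
  rewrite ger0_norm ?subr_ge0 ?lerXn2r// subr_sqr.
  move: kb; rewrite ltrBlDr -ltrBlDl ltr_pdivlMr// => kb.
  by apply: le_lt_trans kb; nra.
have := dP (k ^+ 2); rewrite /= in_itv/= andbT sqr_ge0 => /(_ isT kd).
by have := Tc x; rewrite -/k => h1 /(le_lt_trans (ler_norm _)); lra.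
Qed.

Lemma ber_le_sqrt_ber_norm A : bounded_op A ->
  ber A <= Num.sqrt (ber_norm (adjoint A \o A)).
Proof.
move=> bA; apply: ber_le => x; set k := nkernel H x.
have k1 : rnorm k = 1 := rnorm_nkernel x.
rewrite (le_trans (dot_le _ _))// k1 mulr1 -[leLHS]ger0_norm ?rnorm_ge0//.
rewrite -sqrtr_sqr ler_wsqrtr// -rdot_adjoint_comp//.
by apply: rdot_le_ber_norm; have [] := selfadjoint_adjoint_comp bA.
Qed.

Lemma cfc_absop_jensen f A : is_orlicz f -> bounded_op A ->
  bounded_op (cfc f (absop A \o absop A)) /\
  forall v, rnorm v = 1 ->
    f (rnorm (A v) ^+ 2) <= rdot (cfc f (absop A \o absop A) v) v.
Proof.
move=> of_ bA; have saT := selfadjoint_adjoint_comp bA.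
have [L L0 LP] := bounded_op_bound bA.
(* The added [1] makes the segment nondegenerate when [L = 0]. *)
have M0 : 0 < L ^+ 2 + 1 by rewrite ltr_wpDl// sqr_ge0.
have TM v : 0 <= rdot ((adjoint A \o A) v) v <= (L ^+ 2 + 1) * rnorm v ^+ 2.
  rewrite rdot_adjoint_comp// sqr_ge0/= mulrDl mul1r.
  rewrite (@le_trans _ _ ((L * rnorm v) ^+ 2))//.
    by rewrite lerXn2r ?nnegrE ?mulr_ge0 ?rnorm_ge0 ?LP.
  by rewrite exprMn lerDl sqr_ge0.
have -> : absop A \o absop A = adjoint A \o A.
  apply: (cfc_sqrt_sqr saT M0 TM); apply: (cfcP saT M0 TM).
  by apply: continuous_subspaceT; exact: sqrt_continuous.
have cT : is_cfc f (adjoint A \o A) (cfc f (adjoint A \o A)).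
  apply: (cfcP saT M0 TM); apply: continuous_subspaceW (orlicz_continuous of_).
  by apply: subset_itvl; rewrite bnd_simp.
split; first by have [] := cT.
by move=> v v1; rewrite -rdot_adjoint_comp//; exact: (cfc_jensen saT M0 TM of_ cT).
Qed.

(** At each kernel both diagonal entries dominate the left side, hence so does their average, half a
    diagonal entry of the sum. *)
Lemma orlicz_ber_le_cfc f A : is_orlicz f -> bounded_op A ->
  f (ber A ^+ 2) <= 2^-1 * ber_norm (cfc f (absop A \o absop A) \+
    cfc f (absop (adjoint A) \o absop (adjoint A))).
Proof.
move=> of_ bA; have [bB BE] := adjointP bA.
have [bS1 J1] := cfc_absop_jensen of_ bA.
have [bS2 J2] := cfc_absop_jensen of_ bB.
apply: orlicz_ber_le => // x; set k := nkernel H x.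
have k1 : rnorm k = 1 := rnorm_nkernel x.
set c := cabs _; have c0 : 0 <= c by exact: cabs_ge0.
have f_le (d : R) : c <= d -> f (c ^+ 2) <= f (d ^+ 2).
  move=> cd; have d0 := le_trans c0 cd.
  by apply: (orlicz_nondecreasing of_); rewrite ?in_itv/= ?andbT ?sqr_ge0// lerXn2r.
have h1 : f (c ^+ 2) <= rdot (cfc f (absop A \o absop A) k) k.
  apply: le_trans (J1 k k1); apply: f_le.
  by rewrite (le_trans (dot_le _ _))// k1 mulr1.
have h2 : f (c ^+ 2) <= rdot (cfc f (absop (adjoint A) \o absop (adjoint A)) k) k.
  apply: le_trans (J2 k k1); apply: f_le.
  by rewrite /c BE (le_trans (dot_le _ _))// k1 mul1r.
have bS : bounded_op (cfc f (absop A \o absop A) \+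
    cfc f (absop (adjoint A) \o absop (adjoint A))).
  have := bounded_op_addZ 1 bS1 bS2; congr bounded_op.
  by apply/funext => v; rewrite scale1r.
have := rdot_le_ber_norm x bS; rewrite rdotDl -/k; lra.
Qed.

End Berezin.

(** * Lower bounds for interpolated means and the final inequality *)

(** Betweenness at equal arguments gives [a <= st t a a], and monotonicity does the rest. *)
Lemma path_mean_ge (R : realType) (s : R -> R -> R) (st : R -> R -> R -> R)
    (t a b c : R) : is_interpolational_path s st -> 0 <= t <= 1 ->
  0 <= a -> a <= b -> a <= c -> a <= st t b c.
Proof.
move=> sp t01 a0 ab ac; have mt := path_mean sp t01.
have /andP[aa _] := mean_between mt a0 (lexx a).
exact: le_trans aa (mean_monotone mt a0 ab a0 ac).
Qed.

Theorem theorem3p4 (R : realType) (X : Type) (X_nonempty : inhabited X)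
    (H : rkhs R X) (kernel_neq0 : forall x : X, kernel H x != 0)
    (A : H -> H) (A_bounded : bounded_op A)
    (sigma rho tau : R -> R -> R)
    (sigmat rhot taut : R -> R -> R -> R)
    (sigma_mean : is_symmetric_mean sigma)
    (rho_mean : is_symmetric_mean rho)
    (tau_mean : is_symmetric_mean tau)
    (sigma_path : is_interpolational_path sigma sigmat)
    (rho_path : is_interpolational_path rho rhot)
    (tau_path : is_interpolational_path tau taut)
    (mu nu lambda : R)
    (mu01 : 0 <= mu <= 1) (nu01 : 0 <= nu <= 1) (lambda01 : 0 <= lambda <= 1)
    (f : R -> R) (f_orlicz : is_orlicz f) :
  f (ber A ^+ 2) <=
  rhot lambda
    (sigmat mu (f (ber A ^+ 2))
       (f (ber A * Num.sqrt (ber_norm (adjoint A \o A)))))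
    (taut nu (f (ber A ^+ 2))
       (2^-1 * ber_norm (cfc f (absop A \o absop A) \+
                         cfc f (absop (adjoint A) \o absop (adjoint A))))).
Proof.
have b0 := ber_ge0 kernel_neq0 X_nonempty A_bounded.
have bS := ber_le_sqrt_ber_norm kernel_neq0 X_nonempty A_bounded.
have f0 : 0 <= f (ber A ^+ 2) by rewrite (orlicz_ge0 f_orlicz)// sqr_ge0.
apply: (path_mean_ge rho_path) => //.
  apply: (path_mean_ge sigma_path) => //.
  apply: (orlicz_nondecreasing f_orlicz); rewrite ?in_itv/= ?andbT ?sqr_ge0//.
    by rewrite mulr_ge0// sqrtr_ge0.
  by rewrite expr2 ler_wpM2l.
by apply: (path_mean_ge tau_path) => //; exact: orlicz_ber_le_cfc.
Qed.
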